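(* Let $\{X_m\}_{m\in\mathbb{Z}}$ be a stationary process and let $A\in\mathcal{C}^n$. Assume that there are a real number $\rho(A)\in[0,1)$ and a sequence $(d_i(A))_{i\ge1}$ converging to $0$ such that $|\rho_i(A)-\rho(A)|\le d_i(A)$ for all $i\ge1$, and put $\overline{d}(A)=\sup\{d_i(A): i\ge1\}$. Then there is $c(A)\in[0,1)$ such that for all integers $k\ge0$, $$\left|\mathbb{P}_A(S_A=k)-(1-\rho(A))\rho(A)^k\right|\le c(A)^k\sum_{i=1}^{k+1}d_i(A)\le c(A)^k(k+1)\,\overline{d}(A).$$
   Context: Setting: $\mathcal{C}$ is a finite set, $\Omega=\mathcal{C}^{\mathbb{Z}}$, $X_m:\Omega\to\mathcal{C}$ is the $m$-th coordinate projection, $T:\Omega\to\Omega$ is the left shift, $(T(x))_m=x_{m+1}$. $\mathbb{P}$ is a $T$-invariant probability measure on the product $\sigma$-algebra, with no singleton (symbol) of probability $0$. Write $\mathbb{P}_V(W)=\mathbb{P}(W\mid V)$. The notation $A\in\mathcal{C}^n$ (an $n$-string) means $A=\{X_0=a_0,\dots,X_{n-1}=a_{n-1}\}$ with $a_i\in\mathcal{C}$. Period: $\tau(A)=\min\{k\in\{1,\dots,n\}: A\cap T^{-k}(A)\neq\emptyset\}$. Sojourn time: $S_A(x)=\sup\{k\ge 1: x\in A\cap T^{-j\tau(A)}A\ \text{for all } j=1,\dots,k\}$, with $S_A(x)=0$ if the supremum is over the empty set. For $i\ge1$, $\rho_i(A)=\mathbb{P}\big(A\,\big|\,\bigcap_{j=1}^{i}T^{j\tau(A)}A\big)$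 (the conditioning events having positive probability, so that these quantities are defined; likewise $\mathbb{P}(A)>0$). Convention: $0^0=1$. *)

(* Defs.v *)
From mathcomp Require Import all_boot all_order all_algebra.
From mathcomp Require Import all_classical all_reals all_analysis.

Set Implicit Arguments.
Unset Strict Implicit.
Unset Printing Implicit Defensive.

Import Order.TTheory GRing.Theory Num.Theory.
Import numFieldNormedType.Exports.

Local Open Scope classical_set_scope.
Local Open Scope ring_scope.

(* Every subset of the finite alphabet C is measurable, so the product
   sigma-algebra on C^Z is generated by all the preimages of subsets of C under
   the coordinate projections.  The pointedType structure on C, which
   measurableType requires, only says that C is non-empty. *)
Definition coord_sets (C : pointedType) : set (set (int -> C)) :=
  [set W | exists m : int, exists B : set C, W = (fun x => x m) @^-1` B].
Arguments coord_sets C : clear implicits.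

Definition Omega (C : pointedType) := g_sigma_algebraType (coord_sets C).

Definition X (C : pointedType) (m : int) (x : Omega C) : C := x m.

Definition shift (C : pointedType) (x : Omega C) : Omega C :=
  fun m => x (m + 1).

Definition shift_invariant (R : realType) (C : pointedType)
    (P : probability (Omega C) R) : Prop :=
  forall W : set (Omega C), measurable W -> P (@shift C @^-1` W) = P W.

Definition cyl (C : pointedType) (n : nat) (a : n.-tuple C) : set (Omega C) :=
  [set x | forall i : 'I_n, X (Posz i) x = tnth a i].

(* The default value n of the minimum is harmless: when n >= 1 the index n
   itself satisfies the condition, see periodP. *)
Definition period (C : pointedType) (n : nat) (a : n.-tuple C) : nat :=
  \big[minn/n]_(1 <= k < n.+1 |
      `[< cyl a `&` iter k (@shift C) @^-1` cyl a !=set0 >]) k.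

Definition returns (C : pointedType) (n : nat) (a : n.-tuple C)
    (x : Omega C) : set nat :=
  [set k | (1 <= k)%N /\
     forall j, (1 <= j <= k)%N ->
       (cyl a `&` iter (j * period a) (@shift C) @^-1` cyl a) x].

(* The supremum may be +oo. *)
Definition sojourn (R : realType) (C : pointedType) (n : nat) (a : n.-tuple C)
    (x : Omega C) : \bar R :=
  if `[< returns a x = set0 >] then 0%E
  else ereal_sup [set (k%:R)%:E | k in returns a x].

(* P (W | V); meaningful when P V > 0. *)
Definition cprob (R : realType) (C : pointedType) (P : probability (Omega C) R)
    (W V : set (Omega C)) : R :=
  fine (P (W `&` V)) / fine (P V).

Definition past (C : pointedType) (n : nat) (a : n.-tuple C) (i : nat)
    : set (Omega C) :=
  \bigcap_(j in [set j | (1 <= j <= i)%N])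
    (iter (j * period a) (@shift C) @` cyl a).

Definition rho_ (R : realType) (C : pointedType) (P : probability (Omega C) R)
    (n : nat) (a : n.-tuple C) (i : nat) : R :=
  cprob P (cyl a) (past a i).

Lemma iter_shiftE (C : pointedType) (k : nat) (x : Omega C) (m : int) :
  iter k (@shift C) x m = x (m + k%:Z).
Proof.
elim: k m => [|k IHk] m /=; first by rewrite addr0.
by rewrite /shift IHk -addrA -PoszD add1n.
Qed.

Lemma periodP (C : pointedType) (n : nat) (a : n.-tuple C) : (1 <= n)%N ->
  [/\ (1 <= period a <= n)%N,
      cyl a `&` iter (period a) (@shift C) @^-1` cyl a !=set0 &
      forall k, (1 <= k <= n)%N ->
        cyl a `&` iter k (@shift C) @^-1` cyl a !=set0 ->
        (period a <= k)%N].
Proof.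
move=> n1; pose Q k := cyl a `&` iter k (@shift C) @^-1` cyl a !=set0.
have Qn : Q n.
  exists (fun m : int => nth point a (`|m| %% n)%N); split => /= i.
    by rewrite /X /= modn_small ?ltn_ord// (tnth_nth point).
  rewrite /X iter_shiftE -PoszD /= modnDr modn_small ?ltn_ord//.
  by rewrite (tnth_nth point).
have [h1 h2] : (1 <= period a <= n)%N /\ Q (period a).
  rewrite /period big_nat_cond.
  apply: (big_ind (fun k => (1 <= k <= n)%N /\ Q k)).
  - by rewrite n1 leqnn.
  - by move=> k l hk hl; rewrite /minn; case: ifP.
  - by move=> k /andP[]; rewrite ltnS => hk /asboolP.
split=> // k /andP[k1 kn] Qk; rewrite /period.
have : k \in index_iota 1 n.+1 by rewrite mem_index_iota k1 ltnS.
elim: (index_iota 1 n.+1) => // l r IHr; rewrite inE big_cons.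
have [<- _|_ /= kr] := eqVneq k l; first by rewrite (asboolT Qk) geq_minl.
by case: ifP => _; [exact: leq_trans (geq_minr _ _) (IHr kr)|exact: IHr].
Qed.

(* Main.v *)
Require Import Defs.
From mathcomp Require Import all_boot all_order all_algebra.
From mathcomp Require Import all_classical all_reals all_analysis.
From mathcomp Require Import ring lra zify.

Set Implicit Arguments.
Unset Strict Implicit.
Unset Printing Implicit Defensive.

Import Order.TTheory GRing.Theory Num.Theory.
Import numFieldNormedType.Exports.

Local Open Scope classical_set_scope.
Local Open Scope ring_scope.

(** Let [q k] be the probability that [A] occurs at the times
    [0, tau, ..., k * tau].  Translating by a multiple of [tau] gives
    [rho_(k+1) = r k] with [r k = q (k+1) / q k].  The sojourn time of a point
    of [A] is [k] exactly when the run of occurrences of [A] starting at time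
    [0] survives [k] steps but not [k+1], so that
    [P_A (S = k) = (q k - q (k+1)) / q 0 = (1 - r k) * \prod_(i < k) r i]
    ([cprob_sojourn]): a geometric law whose success rates vary with time.

    The exponential factor needs the [r i] to stay away from [1].  A run
    that breaks at step [k+2] is, seen one period later, a run that breaks at
    step [k+1]; hence [q] is convex ([run_prob_convex]).  If some [r i] were
    [1], then [q] would be constant from there on and [r] could not converge
    to [rho < 1] ([convex_ratio_lt1]).  Together with [r i --> rho < 1] this
    gives a bound [M < 1] for all the [r i] ([uniform_bound_lt1]).

    What remains is a statement on real sequences
    ([stopping_law_near_geometric]).  When [rho > 0], changing the factors of
    [\prod_(i < k) r i] into [rho] one at a time costs [M' ^ (k - 1) * d]
    each, with [M' = max M rho]; the missing power of the rate is supplied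
    by the factor [1 - rho < 1] in front.  When [rho = 0] that
    factor is [1] and gives nothing.  Instead the product of [k] positive
    numbers bounded by [M] is at most [M ^ (k - 1)] times their mean, which gains a factor
    [1 / k <= 1 / 2] as soon as [k >= 2]; for [k = 1] the gain is [1 - r 1],
    which is less than [1] since [r 1] is positive. *)

(** * Products of rates bounded away from 1 *)

Lemma prod_le_expn (R : realType) (r : nat -> R) (c : R) :
  (forall i, 0 < r i) -> (forall i, r i <= c) ->
  forall k, \prod_(i < k) r i <= c ^+ k.
Proof.
move=> r0 rc k; rewrite -[in leRHS](card_ord k) -prodr_const.
by apply: ler_prod => i _; rewrite rc ltW.
Qed.

(** The factor [c] on the left stands for the missing power in
    [c ^ (k - 1)]; writing it there avoids a truncated exponent at [k = 0]. *)
Lemma dist_prod_expn (R : realType) (r e : nat -> R) (rho c : R) :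
  0 <= rho <= c -> (forall i, 0 < r i) -> (forall i, r i <= c) ->
  (forall i, `|r i - rho| <= e i) ->
  forall k, c * `|\prod_(i < k) r i - rho ^+ k| <= c ^+ k * \sum_(i < k) e i.
Proof.
move=> /andP[rho0 rhoc] r0 rc re; have c0 : 0 <= c by exact: le_trans rhoc.
elim=> [|k IH]; first by rewrite !big_ord0 subrr normr0 !mulr0.
rewrite !big_ord_recr /= exprS.
set p := \prod_(i < k) r i in IH *; set s := \sum_(i < k) e i in IH *.
have p0 : 0 <= p by apply: prodr_ge0 => i _; exact: ltW.
have -> : p * r k - rho * rho ^+ k = p * (r k - rho) + rho * (p - rho ^+ k).
  by ring.
apply: (@le_trans _ _ (c * (p * `|r k - rho|) + rho * (c * `|p - rho ^+ k|))).
  rewrite [rho * (c * _)]mulrCA -mulrDr ler_wpM2l// (le_trans (ler_normD _ _))//.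
  by rewrite !normrM (ger0_norm p0) (ger0_norm rho0).
have -> : c ^+ k.+1 * (s + e k) = c * (c ^+ k * e k) + c * (c ^+ k * s).
  by rewrite exprS; ring.
apply: lerD.
  by rewrite ler_wpM2l// ler_pM// prod_le_expn.
by apply: ler_pM => //; rewrite mulr_ge0.
Qed.

(** Each [r i] dominates the product of all the rates divided by
    [c ^ (k - 1)]; the bound is the sum of these inequalities. *)
Lemma prod_le_mean (R : realType) (r : nat -> R) (c : R) :
  (forall i, 0 < r i) -> (forall i, r i <= c) ->
  forall k, c * (k%:R * \prod_(i < k) r i) <= c ^+ k * \sum_(i < k) r i.
Proof.
move=> r0 rc; have c0 : 0 <= c by rewrite (le_trans _ (rc 0)) ?ltW.
elim=> [|k IH]; first by rewrite !big_ord0 mul0r !mulr0.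
rewrite !big_ord_recr /=.
set p := \prod_(i < k) r i in IH *; set s := \sum_(i < k) r i in IH *.
have p0 : 0 <= p by apply: prodr_ge0 => i _; exact: ltW.
have -> : c * (k.+1%:R * (p * r k)) = r k * (c * (k%:R * p)) + c * (p * r k).
  by rewrite -natr1; ring.
have -> : c ^+ k.+1 * (s + r k) = c * (c ^+ k * s) + c * (c ^+ k * r k).
  by rewrite exprS; ring.
apply: lerD.
  by apply: ler_pM => //; [exact: ltW | rewrite !mulr_ge0].
rewrite ler_wpM2l// ler_wpM2r ?prod_le_expn//; exact: ltW.
Qed.

(** From some rank on the rates are below [(1 + rho) / 2]; only finitely many
    rates remain. *)
Lemma uniform_bound_lt1 (R : realType) (r e : nat -> R) (rho : R) :
  rho < 1 -> (forall i, r i < 1) -> (forall i, `|r i - rho| <= e i) ->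
  e @ \oo --> (0 : R) -> exists2 M : R, M < 1 & forall i, r i <= M.
Proof.
move=> rho1 r1 re e0; have h0 : 0 < (1 - rho) / 2 by lra.
have /cvgrPdist_le/(_ _ h0)[N _ Ne] := e0.
exists (\big[Num.max/((1 + rho) / 2)]_(i < N) r i).
  by apply: bigmax_lt => [|i _]; [lra | exact: r1].
move=> i; have [Ni|iN] := leqP N i; last first.
  exact: (le_bigmax _ (fun j : 'I_N => r j) (Ordinal iN)).
apply: (@le_trans _ _ ((1 + rho) / 2)); last exact: bigmax_ge_id.
have := Ne i Ni; rewrite sub0r normrN => /ler_normlP[_ ei].
by have /ler_normlP[_ ri] := re i; lra.
Qed.

(** The product [(1 - r k) * \prod_(i < k) r i] is the probability that
    trials with success probabilities [r 0, r 1, ...] first fail at trial [k].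
    With [M < 1] a bound for the rates, [c] is the largest of [M], [rho] and
    [1 - rho] when [rho > 0], and the largest of [M], [1 / 2] and [1 - r 1]
    when [rho = 0]. *)
Lemma stopping_law_near_geometric (R : realType) (r e : nat -> R) (rho : R) :
  0 <= rho < 1 -> (forall i, 0 < r i < 1) -> (forall i, `|r i - rho| <= e i) ->
  e @ \oo --> (0 : R) ->
  exists c : R, 0 <= c < 1 /\ forall k,
    `|(1 - r k) * \prod_(i < k) r i - (1 - rho) * rho ^+ k|
      <= c ^+ k * \sum_(i < k.+1) e i.
Proof.
move=> /andP[rho0 rho1] r01 re e0.
have r0 i : 0 < r i by case/andP: (r01 i).
have r1 i : r i < 1 by case/andP: (r01 i).
have e_ge0 i : 0 <= e i by exact: le_trans (re i).
have [M M1 rM] := uniform_bound_lt1 rho1 r1 re e0.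
have M0 : 0 < M by exact: lt_le_trans (rM 0).
have p0 k : 0 <= \prod_(i < k) r i by apply: prodr_ge0 => i _; exact: ltW.
have [rhoE|rho_gt0] := eqVneq rho 0; last first.
  have {}rho_gt0 : 0 < rho by rewrite lt_neqAle eq_sym rho_gt0.
  pose c := Num.max M (Num.max rho (1 - rho)).
  have Mc : M <= c by rewrite /c le_max lexx.
  have rhoc : rho <= c by rewrite /c !le_max lexx orbT.
  have rhoc' : 1 - rho <= c by rewrite /c !le_max lexx !orbT.
  have rc i : r i <= c by exact: le_trans Mc.
  exists c; split.
    rewrite (le_trans (ltW M0) Mc)/= /c !gt_max M1 rho1/=; lra.
  move=> k; rewrite big_ord_recr /= mulrDr.
  set p := \prod_(i < k) r i.
  (* The first part of the error carries the small factor [1 - rho <= c],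
     the second one has a full power [c ^ k]. *)
  have -> : (1 - r k) * p - (1 - rho) * rho ^+ k =
            (1 - rho) * (p - rho ^+ k) - p * (r k - rho) by ring.
  rewrite (le_trans (ler_normB _ _))// lerD//; last first.
    by rewrite normrM ger0_norm ?p0// ler_pM ?prod_le_expn ?p0.
  rewrite normrM (ger0_norm (_ : 0 <= 1 - rho)); last by rewrite subr_ge0 ltW.
  apply: (@le_trans _ _ (c * `|p - rho ^+ k|)); first by rewrite ler_wpM2r.
  by apply: dist_prod_expn => //; rewrite rho0.
have re' i : r i <= e i.
  by rewrite (le_trans _ (re i))// rhoE subr0 ler_norm.
pose c := Num.max M (Num.max (1 / 2) (1 - r 1%N)).
have Mc : M <= c by rewrite /c le_max lexx.
have hc : 1 / 2 <= c by rewrite /c !le_max lexx orbT.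
have r1c : 1 - r 1%N <= c by rewrite /c !le_max lexx !orbT.
have c0 : 0 <= c by lra.
have rc i : r i <= c by exact: le_trans Mc.
exists c; split.
  by rewrite c0 /c !gt_max M1/=; have := r0 1%N; lra.
case=> [|[|k]].
- rewrite big_ord0 big_ord1 !expr0 !mulr1 mul1r.
  have -> : 1 - r 0%N - (1 - rho) = - (r 0%N - rho) by ring.
  by rewrite normrN.
(* For [k = 1] the mean of the rates gains nothing, but [1 - r 1 <= c]. *)
- rewrite rhoE subr0 expr1 mulr0 subr0 big_ord1 !big_ord_recr big_ord0 /= add0r.
  have r1' : 0 <= 1 - r 1%N by rewrite subr_ge0 ltW.
  have r0' := ltW (r0 0).
  by rewrite ger0_norm ?mulr_ge0// ler_pM// (le_trans (re' 0))// lerDl.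
- rewrite rhoE expr0n/= mulr0 subr0 ger0_norm ?mulr_ge0 ?p0 ?subr_ge0 ?(ltW (r1 _))//.
  set p := \prod_(i < k.+2) r i.
  (* Since [c >= 1 / 2], there are enough rates for [c * k.+2 >= 1]. *)
  apply: (@le_trans _ _ (c * (k.+2%:R * p))).
    rewrite mulrA ler_wpM2r ?p0// (@le_trans _ _ 1)//.
      by have := r0 k.+2; lra.
    have : 2 <= k.+2%:R :> R by rewrite ler_nat.
    by nra.
  apply: le_trans (prod_le_mean r0 rc _) _.
  rewrite ler_wpM2l ?exprn_ge0// [leRHS]big_ord_recr/= -[leLHS]addr0 lerD//.
  by apply: ler_sum => i _.
Qed.

(** * Runs of occurrences of a string *)

(** The start [m] is an arbitrary integer, so that the conditioning events
    [past a i], which lie at negative times, are runs as well. *)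
Definition run (C : pointedType) (n : nat) (a : n.-tuple C) (m : int) (k : nat)
    : set (Omega C) :=
  [set x | forall j : nat, (j <= k)%N -> forall i : 'I_n,
     X (m + (j * period a)%:Z + i%:Z) x = tnth a i].

Section runs.
Context (C : pointedType) (n : nat) (a : n.-tuple C).

Lemma measurable_run m k : measurable (run a m k).
Proof.
have -> : run a m k = \bigcap_(j in `I_k.+1) \bigcap_(i in [set: 'I_n])
    ((fun x : Omega C => x (m + (j * period a)%:Z + i%:Z)) @^-1`
       [set tnth a i]).
  apply/seteqP; split => x xr.
    by move=> j /= jk i _; exact: xr.
  by move=> j jk i; exact: (xr j jk i I).
apply: bigcap_measurable; first by exists 0%N.
move=> j _; apply: fin_bigcap_measurable => // i _.
by apply: sub_sigma_algebra; do 2 eexists.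
Qed.

Lemma run0E : run a 0 0 = cyl a.
Proof.
apply/seteqP; split => x /= xa; first by move=> i; have := xa 0%N isT i.
by move=> [|//] _ i; rewrite mul0n !add0r; exact: xa.
Qed.

Lemma runW m k l : (l <= k)%N -> run a m k `<=` run a m l.
Proof. by move=> lk x xr j jl; exact: xr (leq_trans jl lk). Qed.

Lemma runS m k : run a m k.+1 `<=` run a m k.
Proof. exact: runW. Qed.

Lemma run_split m k x : run a m k.+1 x <->
  run a m 0 x /\ run a (m + (period a)%:Z) k x.
Proof.
split=> [xr|[x0 xr] [|j] jk i]; last 2 first.
- exact: x0.
- by rewrite -(xr j jk i) mulSn PoszD addrA.
split=> [[|//] _ i|j jk i]; first exact: (xr 0%N isT i).
by rewrite -(xr j.+1 jk i) mulSn PoszD addrA.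
Qed.

Lemma shift_preimage_run m k :
  @Defs.shift C @^-1` run a m k = run a (m + 1) k.
Proof.
have E (j : nat) (i : 'I_n) : m + (j * period a)%:Z + i%:Z + 1 =
    m + 1 + (j * period a)%:Z + i%:Z by ring.
by apply/seteqP; split => x xr j jk i; have := xr j jk i; rewrite /X /Defs.shift E.
Qed.

Lemma iter_shift_imageE N :
  iter N (@Defs.shift C) @` cyl a =
  [set x | forall i : 'I_n, X (i%:Z - N%:Z) x = tnth a i].
Proof.
apply/seteqP; split => [_ [y ya <-] i | x xa].
  by rewrite /X iter_shiftE subrK; exact: ya.
exists (fun m => x (m - N%:Z)); first by move=> i; exact: xa.
by apply/funext => m; rewrite iter_shiftE addrK.
Qed.

(** [past a k.+1] asks for [A] at the times [- j * tau] with
    [1 <= j <= k.+1]; in increasing order these are the [k.+1] times of a run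
    that starts at [- k.+1 * tau] and stops one period before time [0].
    Intersecting with [A] itself then prolongs the run by one step. *)
Lemma past_run k :
  past a k.+1 = run a (- (k.+1 * period a)%:Z) k.
Proof.
rewrite /past; apply/seteqP; split => x xp j.
  move=> jk i; have := xp (k.+1 - j)%N.
  rewrite iter_shift_imageE => /(_ _ i) <-; last by rewrite /=; lia.
  by rewrite /X; congr (x _); rewrite mulnBl -subzn; [ring | rewrite leq_mul2r; lia].
rewrite iter_shift_imageE => /= jk i; rewrite -(xp (k.+1 - j)%N _ i).
  rewrite /X; congr (x _); rewrite mulnBl -subzn; [ring|rewrite leq_mul2r; lia].
by lia.
Qed.

Lemma cyl_past_run k :
  cyl a `&` past a k.+1 = run a (- (k.+1 * period a)%:Z) k.+1.
Proof.
rewrite past_run; apply/seteqP; split => x.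
  move=> [xa xr] j; rewrite leq_eqVlt => /orP[/eqP -> i|]; last exact: xr.
  by rewrite addNr add0r; exact: xa.
move=> xr; split; last exact: runS.
by move=> i; rewrite -(xr k.+1 (leqnn _) i) addNr add0r.
Qed.

Lemma returns_run k x : returns a x k <-> (1 <= k)%N /\ run a 0 k x.
Proof.
have E j i : X (0 + (j * period a)%:Z + i%:Z) x =
             X i%:Z (iter (j * period a) (@Defs.shift C) x).
  by rewrite /X iter_shiftE add0r addrC.
split=> -[k1 xr]; split => // j.
  move=> jk i; rewrite E; have [->|j0] := posnP j.
    by rewrite mul0n; case: (xr 1%N); rewrite ?k1// => xa _; exact: xa.
  by case: (xr j); rewrite ?j0 ?jk// => _; exact.
move=> /andP[j1 jk]; split=> i; last by rewrite -E; exact: xr.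
by rewrite -(xr 0%N isT i) E mul0n.
Qed.

(** At a point of [A] the set of return indices is an initial segment of the positive integers,
    so its supremum, which may be infinite, equals [k] iff [k] is the last
    index at which the run is unbroken. *)
Lemma sojourn_run (R : realType) k :
  [set x | sojourn R a x = (k%:R)%:E] `&` cyl a = run a 0 k `\` run a 0 k.+1.
Proof.
apply/seteqP; split => x.
  move=> [/= Sk]; rewrite -run0E => x0.
  have le_k l : returns a x l -> (l <= k)%N.
    move=> xl; move: Sk; rewrite /sojourn; case: asboolP => [r0|_ Sk].
      by rewrite r0 in xl.
    have : ((l%:R : R)%:E <= (k%:R)%:E)%E.
      by rewrite -Sk; apply: ereal_sup_ubound; exists l.
    by rewrite lee_fin ler_nat.
  split; last first.
    by move=> xr; have := le_k k.+1; rewrite ltnn => F; apply/notF/F/returns_run.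
  (* A run broken at [k.+1] has all its return indices at most [k], and so a
     sojourn time at most [k]. *)
  apply: contrapT; case: k Sk le_k => [|k] Sk le_k nxr; first exact: nxr x0.
  have lt_k l : returns a x l -> (l <= k)%N.
    move=> xl; have := le_k _ xl; rewrite leq_eqVlt => /orP[/eqP lk|//].
    by exfalso; apply: nxr; rewrite -lk; case/returns_run: xl.
  have : (sojourn R a x <= (k%:R)%:E)%E.
    rewrite /sojourn; case: asboolP => _; first by rewrite lee_fin.
    by apply: ge_ereal_sup => _ [l xl <-]; rewrite lee_fin ler_nat lt_k.
  by rewrite Sk lee_fin ler_nat ltnn.
move=> [xr nxr]; split; last by rewrite -run0E; exact: runW xr.
have le_k l : returns a x l -> (l <= k)%N.
  by rewrite leqNgt => /returns_run[_ xl]; apply/negP => kl; exact/nxr/(runW kl).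
rewrite /= /sojourn; case: asboolP => [r0|/eqP/set0P[l xl]].
  have [->//|k0] := posnP k.
  have xk : returns a x k by apply/returns_run.
  by rewrite r0 in xk.
have k1 : (1 <= k)%N.
  by apply: leq_trans (le_k _ xl); case/returns_run: xl.
apply/eqP; rewrite eq_le; apply/andP; split.
  by apply: ge_ereal_sup => _ [m xm <-]; rewrite lee_fin ler_nat le_k.
by apply: ereal_sup_ubound; exists k => //; exact/returns_run.
Qed.

(** * Run probabilities under a stationary law *)

Section stationary.
Context (R : realType) (P : probability (Omega C) R)
  (Pinv : shift_invariant P).

Lemma prob_run_translate m N k : P (run a (m + N%:Z) k) = P (run a m k).
Proof.
elim: N => [|N IH]; first by rewrite addr0.
rewrite -addn1 PoszD addrA -shift_preimage_run Pinv//.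
exact: measurable_run.
Qed.

Definition run_prob (k : nat) : R := fine (P (run a 0 k)).

Lemma run_probE k : P (run a 0 k) = (run_prob k)%:E.
Proof. by rewrite /run_prob fineK// fin_num_measure//; exact: measurable_run. Qed.

Lemma prob_run_past i k :
  P (run a (- (i * period a)%:Z) k) = (run_prob k)%:E.
Proof. by rewrite -(prob_run_translate _ (i * period a)) addNr run_probE. Qed.

Lemma rho_run_prob k : rho_ P a k.+1 = run_prob k.+1 / run_prob k.
Proof. by rewrite /rho_ /cprob cyl_past_run past_run !prob_run_past. Qed.

Lemma prob_run_diff m k :
  P (run a m k `\` run a m k.+1) = (P (run a m k) - P (run a m k.+1))%E.
Proof.
rewrite measureD; [|exact: measurable_run..|]; last first.
  by rewrite ltey_eq fin_num_measure//; exact: measurable_run.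
by rewrite (setIidr (@runS _ _)).
Qed.

Lemma cprob_sojourn k :
  cprob P [set x | sojourn R a x = (k%:R)%:E] (cyl a) =
  (run_prob k - run_prob k.+1) / run_prob 0.
Proof. by rewrite /cprob sojourn_run -run0E prob_run_diff !run_probE. Qed.

Lemma run_prob_noninc k : run_prob k.+1 <= run_prob k.
Proof.
rewrite -lee_fin -!run_probE le_measure ?inE//; by [exact: measurable_run|exact: runS].
Qed.

(** A run from time [0] that breaks exactly at step [k.+2] contains a run from
    time [tau] that breaks exactly at step [k.+1]; by stationarity the latter
    has probability [run_prob k - run_prob k.+1]. *)
Lemma run_prob_convex k :
  run_prob k.+1 - run_prob k.+2 <= run_prob k - run_prob k.+1.
Proof.
rewrite -lee_fin !EFinB -!run_probE -prob_run_diff.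
rewrite -(prob_run_translate 0 (period a) k).
rewrite -(prob_run_translate 0 (period a) k.+1) -prob_run_diff.
apply: le_measure; rewrite ?inE; [by apply: measurableD; exact: measurable_run..|].
move=> x [/run_split[x0 xr] nxr]; split=> // xr'.
by apply/nxr/run_split.
Qed.

End stationary.
End runs.

(** A convex nonincreasing sequence with two equal consecutive terms is
    constant afterwards, and then its ratios converge to [1]. *)
Lemma convex_ratio_lt1 (R : realType) (q e : nat -> R) (rho : R) :
  (forall k, 0 < q k) -> (forall k, q k.+1 <= q k) ->
  (forall k, q k.+1 - q k.+2 <= q k - q k.+1) ->
  rho < 1 -> (forall k, `|q k.+1 / q k - rho| <= e k) -> e @ \oo --> (0 : R) ->
  forall k, q k.+1 / q k < 1.
Proof.
move=> q0 qn qc rho1 qe e0 k; rewrite ltr_pdivrMr// mul1r lt_neqAle qn andbT.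
apply/eqP => qk.
have flat i : q (i + k).+1 = q (i + k)%N.
  elim: i => [//|i IH]; apply/eqP; rewrite addSn eq_le qn/=.
  by have := qc (i + k)%N; rewrite IH subrr subr_le0.
have h0 : 0 < (1 - rho) / 2 by lra.
have /cvgrPdist_le/(_ _ h0)[N _ Ne] := e0.
have := Ne (N + k)%N (leq_addr _ _); rewrite sub0r normrN => /ler_normlP[_ ei].
have /ler_normlP[_] := qe (N + k)%N.
by rewrite flat divff ?gt_eqF//; lra.
Qed.

(** * The two bounds on the law of the sojourn time *)

(** Convergence bounds [d], without which its supremum would be a default
    value. *)
Lemma sum_le_sup (R : realType) (d : nat -> R) (l : R) (k : nat) :
  d @ \oo --> l ->
  \sum_(1 <= i < k.+1) d i <= k%:R * sup [set d i | i in [set i | (1 <= i)%N]].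
Proof.
move=> dl; have -> : k%:R * sup [set d i | i in [set i | (1 <= i)%N]] =
    \sum_(1 <= i < k.+1) sup [set d i | i in [set i | (1 <= i)%N]].
  by rewrite sumr_const_nat subn1 mulr_natl.
rewrite !big_nat; apply: ler_sum => i /andP[i1 _].
have /cvg_seq_bounded[M [_ Md]] : cvgn d by exact: cvgP dl.
apply: ub_le_sup; last by exists i.
exists (M + 1) => _ [j _ <-]; rewrite (le_trans (ler_norm _))//.
by apply: (Md (M + 1)) => //; rewrite ltrDl.
Qed.

Theorem theorem5p1 (R : realType) (C : pointedType)
    (finC : finite_set [set: C])
    (P : probability (Omega C) R)
    (Pinv : shift_invariant P)
    (Psymb : forall s : C, (0 < P (X 0 @^-1` [set s]))%E)
    (n : nat) (n_ge1 : (1 <= n)%N) (a : n.-tuple C)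
    (PA_gt0 : (0 < P (cyl a))%E)
    (Ppast_gt0 : forall i : nat, (1 <= i)%N -> (0 < P (past a i))%E)
    (rho : R) (rho01 : 0 <= rho < 1)
    (d : nat -> R) (d_cvg0 : d @ \oo --> (0 : R))
    (rho_d : forall i : nat, (1 <= i)%N -> `|rho_ P a i - rho| <= d i) :
  let dbar : R := sup [set d i | i in [set i : nat | (1 <= i)%N]] in
  exists c : R, 0 <= c < 1 /\
    forall k : nat,
      `|cprob P [set x | sojourn R a x = (k%:R)%:E] (cyl a)
         - (1 - rho) * rho ^+ k|
        <= c ^+ k * \sum_(1 <= i < k.+2) d i
      /\ c ^+ k * \sum_(1 <= i < k.+2) d i <= c ^+ k * (k.+1)%:R * dbar.
Proof.
move=> dbar; have /andP[_ rho1] := rho01.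
pose q := run_prob a P; pose r k := q k.+1 / q k; pose e k := d k.+1.
have rE k : rho_ P a k.+1 = r k by exact: rho_run_prob.
have q0 k : 0 < q k.
  by have := Ppast_gt0 k.+1 isT; rewrite past_run prob_run_past// lte_fin.
have re k : `|r k - rho| <= e k by rewrite -rE; exact: rho_d.
have e0 : e @ \oo --> (0 : R).
  by rewrite /e cvg_shiftS.
have r01 k : 0 < r k < 1.
  rewrite divr_gt0//=; apply: (convex_ratio_lt1 q0 _ _ rho1 re e0) => i.
    exact: run_prob_noninc.
  exact: run_prob_convex.
have [c [c01 Hc]] := stopping_law_near_geometric rho01 r01 re e0.
exists c; split=> // k; split; last first.
  rewrite -mulrA ler_wpM2l ?exprn_ge0 ?(andP c01).1//.
  exact: sum_le_sup d_cvg0.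
have qE : q k / q 0%N = \prod_(i < k) r i.
  elim: k => [|k IH]; first by rewrite big_ord0 divff ?gt_eqF.
  by rewrite big_ord_recr /= -IH /r; field; rewrite !gt_eqF.
have -> : cprob P [set x | sojourn R a x = (k%:R)%:E] (cyl a) =
    (1 - r k) * \prod_(i < k) r i.
  by rewrite cprob_sojourn// -qE -/q /r; field; rewrite !gt_eqF.
have -> : \sum_(1 <= i < k.+2) d i = \sum_(i < k.+1) e i.
  by rewrite big_add1 big_mkord.
exact: Hc.
Qed.
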